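(* Let $F\colon\mathbf{Set}\to\mathbf{Set}$ be a weak pullback preserving functor with a well-behaved evaluation function $ev_F$. The Wasserstein lifting $\overline F$, given by $\overline F(X,d)=(FX,W^F_d)$ and $\overline Ff=Ff$, is a functor $\mathbf{PMet}\to\mathbf{PMet}$; in particular, for every nonexpansive $f\colon(X,d_X)\to(Y,d_Y)$ and all $t_1,t_2\in FX$, $W^F_{d_Y}(Ff(t_1),Ff(t_2))\le W^F_{d_X}(t_1,t_2)$.
   Context: Fix $\top\in(0,\infty]$; pseudometrics take values in $[0,\top]$. $\mathbf{PMet}$ is the category of pseudometric spaces and nonexpansive maps ($d_Y(f(x),f(x'))\le d_X(x,x')$). $d_e$ is the Euclidean distance on $[0,\top]$ (with $d_e(a,\infty)=\infty$ for $a\ne\infty$, $d_e(\infty,\infty)=0$). An evaluation function for $F$ is $ev_F\colon F[0,\top]\to[0,\top]$; $\tilde Fg=ev_F\circ Fg$ for $g\colon X\to[0,\top]$. $ev_F$ is well-behaved if (W1) $f\le g$ implies $\tilde Ff\le\tilde Fg$; (W2) for every $t\in F([0,\top]^2)$, $d_e(ev_F(F\pi_1 t),ev_F(F\pi_2 t))\le\tilde Fd_e(t)$; (W3) $ev_F^{-1}[\{0\}]=Fi[F\{0\}]$, $i\colon\{0\}\hookrightarrow[0,\top]$. A coupling of $t_1,t_2\in FX$ is $t\in F(X\times X)$ with $F\pi_i(t)=t_i$; $W^F_d(t_1,t_2)=\inf\{\tilde Fd(t)\mid t\text{ coupling of }t_1,t_2\}$ ($\inf\emptyset=\top$), which under these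 hypotheses is a pseudometric. *)

(* Defs.v *)
From HB Require Import structures.
From mathcomp Require Import all_boot all_order all_algebra.
From mathcomp Require Import boolp classical_sets reals constructive_ereal.
From mathcomp Require Import interval_inference ereal.

Set Implicit Arguments.
Unset Strict Implicit.
Unset Printing Implicit Defensive.

Import Order.TTheory GRing.Theory Num.Theory.

Local Open Scope classical_set_scope.
Local Open Scope ring_scope.
Local Open Scope ereal_scope.

Record category := Category {
  obj :> Type ;
  mor : obj -> obj -> Type ;
  idc : forall X, mor X X ;
  compc : forall X Y Z, mor Y Z -> mor X Y -> mor X Z ;
  comp_idl : forall X Y (f : mor X Y), compc (idc Y) f = f ;
  comp_idr : forall X Y (f : mor X Y), compc f (idc X) = f ;
  compA : forall X Y Z W (h : mor Z W) (g : mor Y Z) (f : mor X Y),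
    compc h (compc g f) = compc (compc h g) f }.

Arguments mor {c} X Y.
Arguments idc {c} X.
Arguments compc {c X Y Z} g f.

Record is_functor (C D : category) (Fo : C -> D)
    (Fm : forall X Y : C, mor X Y -> mor (Fo X) (Fo Y)) : Prop := IsFunctor {
  functor_id : forall X, Fm X X (idc X) = idc (Fo X) ;
  functor_comp : forall X Y Z (g : mor Y Z) (f : mor X Y),
    Fm X Z (compc g f) = compc (Fm Y Z g) (Fm X Y f) }.

Record functor (C D : category) := Functor {
  fobj :> C -> D ;
  fmap : forall X Y : C, mor X Y -> mor (fobj X) (fobj Y) ;
  functorP : is_functor fmap }.

Arguments fmap {C D} f {X Y} _.

Definition is_weak_pullback (C : category) (P A B Z : C) (p1 : mor P A) (p2 : mor P B)
    (f : mor A Z) (g : mor B Z) : Prop :=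
  compc f p1 = compc g p2 /\
  forall (Q : C) (q1 : mor Q A) (q2 : mor Q B), compc f q1 = compc g q2 ->
    exists u : mor Q P, compc p1 u = q1 /\ compc p2 u = q2.

Definition preserves_weak_pullbacks (C D : category) (F : functor C D) : Prop :=
  forall (P A B Z : C) (p1 : mor P A) (p2 : mor P B)
    (f : mor A Z) (g : mor B Z),
  is_weak_pullback p1 p2 f g ->
  is_weak_pullback (fmap F p1) (fmap F p2) (fmap F f) (fmap F g).

Definition SET : category :=
  @Category Type (fun X Y => X -> Y) (fun X => @id X)
    (fun X Y Z g f => g \o f)
    (fun X Y f => erefl) (fun X Y f => erefl) (fun X Y Z W h g f => erefl).

(* [fmap] on plain types; unification does not see [X : Type] as [X : SET]. *)
Definition smap (F : functor SET SET) (X Y : Type) (f : X -> Y) : F X -> F Y :=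
  @fmap SET SET F X Y f.

Arguments smap F {X Y} f _.

Section Interval.
Context {R : realType}.
Variable top : {posnum \bar R}.

Definition itop : Type := {x : \bar R | 0 <= x <= top%:num}.

Definition MkItop (x : \bar R) (xP : 0 <= x <= top%:num) : itop := exist _ x xP.

Lemma izero_subproof : 0 <= (0 : \bar R) <= top%:num.
Proof. by rewrite lexx /= ltW. Qed.

Definition izero : itop := MkItop izero_subproof.

(* The guard is needed because [+oo - +oo = -oo] in [\bar R]. *)
Definition edist (a b : \bar R) : \bar R := if a == b then 0 else `|a - b|.

Lemma edist_le (t a b : \bar R) :
  0 <= t -> 0 <= a <= t -> 0 <= b <= t -> 0 <= edist a b <= t.
Proof.
move=> t0 /andP[a0 aT] /andP[b0 bT]; rewrite /edist.
case: eqP => [_|_]; first by rewrite lexx.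
rewrite abse_ge0 andTb.
have [ay|ay] := eqVneq a +oo.
  by rewrite (_ : t = +oo) ?leey//; apply/eqP; rewrite -leye_eq -ay.
have [by_|by_] := eqVneq b +oo.
  by rewrite (_ : t = +oo) ?leey//; apply/eqP; rewrite -leye_eq -by_.
case: a a0 aT ay => [a| |] a0 aT ay //.
case: b b0 bT by_ => [b| |] b0 bT by_ //.
have [le_ab|/ltW le_ba] := leP a b.
  apply: le_trans bT; rewrite /= lee_fin distrC ger0_norm ?subr_ge0//.
  by rewrite gerBl -lee_fin.
apply: le_trans aT; rewrite /= lee_fin ger0_norm ?subr_ge0//.
by rewrite gerBl -lee_fin.
Qed.

Lemma edist_subproof (p : itop * itop) :
  0 <= edist (sval p.1) (sval p.2) <= top%:num.
Proof. exact: (edist_le (ltW (gt0e top)) (proj2_sig p.1) (proj2_sig p.2)). Qed.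

Definition d_e (p : itop * itop) : itop := MkItop (edist_subproof p).

Lemma iinf_subproof (S : set itop) :
  0 <= Order.min top%:num (ereal_inf [set sval x | x in S]) <= top%:num.
Proof.
rewrite ge_min lexx /= andbT le_min ltW //=.
by apply/ereal_infP => _ [x _ <-]; case/andP: (proj2_sig x).
Qed.

(* Infimum in the complete lattice [[0, top]]; the minimum with [top] only
   matters for [S = set0], where [ereal_inf set0 = +oo]. *)
Definition iinf (S : set itop) : itop := MkItop (iinf_subproof S).

End Interval.

Arguments izero {R} top.

Section PMet.
Context {R : realType}.
Variable top : {posnum \bar R}.

Record is_pseudometric (X : Type) (d : X * X -> itop top) : Prop :=
  IsPseudometric {
  pm_refl : forall x, sval (d (x, x)) = 0 ;
  pm_sym : forall x y, sval (d (x, y)) = sval (d (y, x)) ;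
  pm_triangle : forall x y z,
    sval (d (x, z)) <= sval (d (x, y)) + sval (d (y, z)) }.

Record pmet := MkPMet {
  carrier :> Type ;
  pdist : carrier * carrier -> itop top ;
  pdistP : is_pseudometric pdist }.

Arguments pdist p _ : clear implicits.

Definition nonexpansive (X Y : Type) (dX : X * X -> itop top)
    (dY : Y * Y -> itop top) (f : X -> Y) : Prop :=
  forall x x', sval (dY (f x, f x')) <= sval (dX (x, x')).

Record nexp (X Y : pmet) := MkNexp {
  nexp_fun :> X -> Y ;
  nexpP : nonexpansive (pdist X) (pdist Y) nexp_fun }.

Lemma nexp_eq (X Y : pmet) (f g : nexp X Y) :
  nexp_fun f = nexp_fun g -> f = g.
Proof.
by case: f g => [f fP] [g gP] /= fg; subst g; rewrite (Prop_irrelevance fP gP).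
Qed.

Lemma nexp_id_subproof (X : pmet) : nonexpansive (pdist X) (pdist X) id.
Proof. by move=> x x'. Qed.

Lemma nexp_comp_subproof (X Y Z : pmet) (g : nexp Y Z) (f : nexp X Y) :
  nonexpansive (pdist X) (pdist Z) (g \o f).
Proof. by move=> x x'; exact: le_trans (nexpP g _ _) (nexpP f _ _). Qed.

Definition PMET : category.
Proof.
refine (@Category pmet nexp (fun X => MkNexp (@nexp_id_subproof X))
  (fun X Y Z g f => MkNexp (nexp_comp_subproof g f)) _ _ _).
- by move=> X Y f; exact: nexp_eq.
- by move=> X Y f; exact: nexp_eq.
- by move=> X Y Z W h g f; exact: nexp_eq.
Defined.

End PMet.

Arguments pdist {R top} p _.

Section Wasserstein.
Context {R : realType}.
Variables (top : {posnum \bar R}) (F : functor SET SET).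

Definition evaluation : Type := F (itop top) -> itop top.

Variable ev : evaluation.

Definition tilde (X : Type) (g : X -> itop top) : F X -> itop top :=
  ev \o smap F g.

Definition Fpi1 (X : Type) : F (X * X)%type -> F X := smap F fst.

Definition Fpi2 (X : Type) : F (X * X)%type -> F X := smap F snd.

Record well_behaved : Prop := WellBehaved {
  wb_monotone : forall (X : Type) (f g : X -> itop top),
    (forall x, sval (f x) <= sval (g x)) ->
    forall t, sval (tilde f t) <= sval (tilde g t) ;
  wb_dist : forall t : F (itop top * itop top)%type,
    sval (d_e (ev (Fpi1 t), ev (Fpi2 t))) <= sval (tilde (@d_e R top) t) ;
  wb_zero : ev @^-1` [set izero top] =
    range (smap F (sval : [set izero top] -> itop top)) }.

Definition coupling (X : Type) (t1 t2 : F X) : set (F (X * X)%type) :=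
  [set t | Fpi1 t = t1 /\ Fpi2 t = t2].

Definition wasserstein (X : Type) (d : X * X -> itop top)
    (p : F X * F X) : itop top :=
  iinf [set tilde d t | t in coupling p.1 p.2].

Definition wlift_obj
    (hW : forall X : PMET top, is_pseudometric (wasserstein (pdist X)))
    (X : PMET top) : PMET top :=
  MkPMet (hW X).

Definition wlift_map
    (hW : forall X : PMET top, is_pseudometric (wasserstein (pdist X)))
    (hN : forall (X Y : PMET top) (f : mor X Y),
      nonexpansive (wasserstein (pdist X)) (wasserstein (pdist Y))
        (smap F f))
    (X Y : PMET top) (f : mor X Y) :
    mor (wlift_obj hW X) (wlift_obj hW Y) :=
  @MkNexp _ _ (wlift_obj hW X) (wlift_obj hW Y) _ (hN X Y f).

End Wasserstein.

(* Main.v *)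
(** A coupling of [t1, t2] is sent by [F (f x f)] to a coupling of
    [F f t1, F f t2], and monotonicity compares the costs.  That the
    Wasserstein distance is a pseudometric rests on two points: couplings can be
    glued, since [X * X * X] is a pullback of [snd, fst : X * X -> X] which [F]
    preserves weakly; and [|d13 - d12| <= d23] turns condition (W2) into
    subadditivity of the cost along the three projections of the glued
    element. *)
Require Import Defs.
From mathcomp Require Import all_boot all_order all_algebra.
From mathcomp Require Import boolp classical_sets reals constructive_ereal.
From mathcomp Require Import interval_inference ereal.
From mathcomp Require Import lra.

Set Implicit Arguments.
Unset Strict Implicit.
Unset Printing Implicit Defensive.

Import Order.TTheory GRing.Theory Num.Theory.

Local Open Scope ereal_scope.

Section ExtendedDistance.
Context {R : realType}.
Implicit Types a b c : \bar R.

Lemma edist_le_add {a b} : 0 <= a -> 0 <= b -> a <= b + edist a b.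
Proof.
rewrite /edist; case: eqP => [->|_]; first by rewrite adde0.
case: a b => [a| |] [b| |] //= _ _; rewrite ?leey //.
by rewrite -EFinD lee_fin -lerBlDl ler_norm.
Qed.

(** The bound is assumed in additive form because sums of nonnegative extended reals are always
    meaningful, unlike differences. *)
Lemma edist_le_of_add {a b c} : 0 <= a -> 0 <= b -> 0 <= c ->
  a <= b + c -> b <= a + c -> edist a b <= c.
Proof.
rewrite /edist; case: eqP => // ab.
case: a b c ab => [a| |] [b| |] [c| |] //= _ _ _ _; rewrite ?leey //.
by rewrite -!EFinD !lee_fin ler_norml => ? ?; apply/andP; split; lra.
Qed.

End ExtendedDistance.

Section Infimum.
Context {R : realType} {top : {posnum \bar R}}.
Implicit Types (a b : itop top) (S T : set (itop top)).

Lemma itop_ge0 a : 0 <= sval a.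
Proof. by case/andP: (proj2_sig a). Qed.

Lemma itop_le_top a : sval a <= top%:num%R.
Proof. by case/andP: (proj2_sig a). Qed.

Lemma itop_inj a b : sval a = sval b -> a = b.
Proof. exact: val_inj. Qed.

Lemma iinf_le S a : S a -> sval (iinf S) <= sval a.
Proof.
move=> Sa; rewrite /= ge_min; apply/orP; right.
by apply: ereal_inf_lbound; exists a.
Qed.

(** The bound by [top] covers empty [S], whose infimum is [top]. *)
Lemma le_iinf S (y : \bar R) : y <= top%:num%R ->
  (forall a, S a -> y <= sval a) -> y <= sval (iinf S).
Proof.
move=> yT yS; rewrite /= le_min yT /=.
by apply/ereal_infP => _ [a Sa <-]; exact: yS.
Qed.

(** A finite [x] can be subtracted, so that [y - x] is a lower bound of [S]; for [x = +oo] the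
    right-hand side is [+oo]. *)
Lemma le_add_iinf S (x y : \bar R) : 0 <= x -> y <= top%:num%R ->
  (forall a, S a -> y <= x + sval a) -> y <= x + sval (iinf S).
Proof.
case: x => [x| |] //.
- rewrite lee_fin => x0 yT yS; rewrite -leeBlDl //; apply: le_iinf.
    by rewrite leeBlDl // (le_trans yT) // leeDr.
  by move=> a /yS; rewrite leeBlDl.
- by move=> _ _ _; rewrite addye ?leey // gt_eqF // (lt_le_trans _ (itop_ge0 _)) ?ltNy0.
Qed.

Lemma le_iinf_add_iinf S T (y : \bar R) : y <= top%:num%R ->
  (forall a b, S a -> T b -> y <= sval a + sval b) ->
  y <= sval (iinf S) + sval (iinf T).
Proof.
move=> yT yST; rewrite addeC; apply: le_add_iinf => //; first exact: itop_ge0.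
move=> a Sa; rewrite addeC; apply: le_add_iinf => //; first exact: itop_ge0.
by move=> b; exact: yST.
Qed.

End Infimum.

Section SetFunctor.
Variable F : functor SET SET.

Lemma smap_id (X : Type) : smap F (@id X) = id.
Proof. exact: (functor_id (functorP F) X). Qed.

Lemma smap_comp (X Y Z : Type) (g : Y -> Z) (f : X -> Y) (t : F X) :
  smap F g (smap F f t) = smap F (g \o f) t.
Proof.
by have /(congr1 (@^~ t)) /esym := @functor_comp _ _ _ _ (functorP F) X Y Z g f.
Qed.

Lemma coupling_swap (X : Type) (t1 t2 : F X) t :
  coupling t1 t2 t -> coupling t2 t1 (smap F (fun p => (p.2, p.1)) t).
Proof. by move=> [h1 h2]; split; rewrite /Fpi1 /Fpi2 smap_comp. Qed.

Lemma coupling_smap (X Y : Type) (f : X -> Y) (t1 t2 : F X) t :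
  coupling t1 t2 t ->
  coupling (smap F f t1) (smap F f t2) (smap F (fun p => (f p.1, f p.2)) t).
Proof. by move=> [<- <-]; split; rewrite /Fpi1 /Fpi2 !smap_comp. Qed.

Lemma coupling_diag (X : Type) (t : F X) :
  coupling t t (smap F (fun x => (x, x)) t).
Proof.
by split; rewrite /Fpi1 /Fpi2 smap_comp; exact: (congr1 (@^~ t) (smap_id X)).
Qed.

Lemma coupling_glue (X : Type) (t1 t2 t3 : F X) s u :
  preserves_weak_pullbacks F -> coupling t1 t2 s -> coupling t2 t3 u ->
  exists w : F (X * X * X)%type,
    smap F fst w = s /\ smap F (fun p => (p.1.2, p.2)) w = u.
Proof.
move=> hF [_ s2] [u1 _].
have wpb : @is_weak_pullback SET (X * X * X)%type (X * X)%type (X * X)%type X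
    fst (fun p => (p.1.2, p.2)) snd fst.
  (* Pairs [(x, y)] and [(y, z)] sharing their middle point are merged into [((x, y), z)]. *)
  split=> // Q q1 q2 q12; exists (fun q => (q1 q, (q2 q).2)); split=> //.
  apply: funext => q /=; move: (congr1 (@^~ q) q12) => /=.
  by case: (q2 q) => a b /= ->.
have [_ lift] := hF _ _ _ _ _ _ _ _ wpb.
(* Elements are maps out of [unit]; [s] and [u] form a cone because both have [t2] as middle
   marginal. *)
have [|v [v1 v2]] := lift unit (fun=> s) (fun=> u).
  by apply: funext => ?; rewrite /= -[LHS]/(Fpi2 s) s2 -u1.
by exists (v tt); split; [exact: (congr1 (@^~ tt) v1)|exact: (congr1 (@^~ tt) v2)].
Qed.

End SetFunctor.

Section Wasserstein.
Context {R : realType} {top : {posnum \bar R}} {F : functor SET SET}.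
Variable ev : evaluation top F.
Hypothesis hev : well_behaved ev.

Lemma tilde_smap (X Y : Type) (g : Y -> itop top) (f : X -> Y) (t : F X) :
  tilde ev g (smap F f t) = tilde ev (g \o f) t.
Proof. by rewrite /tilde /= smap_comp. Qed.

(** Such a [g] factors through the inclusion of [{0}], so [smap F g t] lies in the range that (W3)
    identifies with the zero set of [ev]. *)
Lemma tilde_eq0 (X : Type) (g : X -> itop top) (t : F X) :
  (forall x, sval (g x) = 0) -> sval (tilde ev g t) = 0.
Proof.
move=> g0.
have gE : g = sval \o (fun=> exist _ (izero top) (mem_set erefl) : [set izero top]%classic).
  by apply: funext => x; apply: itop_inj; rewrite g0.
suff -> : tilde ev g t = izero top by [].
suff : (ev @^-1` [set izero top])%classic (smap F g t) by [].
by rewrite (wb_zero hev) gE -smap_comp; eexists.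
Qed.

(** The hypotheses say that [f] and [g] are pointwise at distance at most [h]. Applying (W2) to the
    image of [t] under the pairing of [f] and [g], then (W1), bounds the distance of their costs by
    that of [h]. *)
Lemma tilde_subadditive (X : Type) (f g h : X -> itop top) (t : F X) :
  (forall x, sval (f x) <= sval (g x) + sval (h x)) ->
  (forall x, sval (g x) <= sval (f x) + sval (h x)) ->
  sval (tilde ev f t) <= sval (tilde ev g t) + sval (tilde ev h t).
Proof.
move=> fgh gfh.
apply: le_trans (edist_le_add (itop_ge0 _) (itop_ge0 (tilde ev g t))) _.
apply: leeD => //.
have := wb_dist hev (smap F (fun x => (f x, g x)) t).
rewrite /Fpi1 /Fpi2 !smap_comp tilde_smap => /le_trans; apply.
apply: (wb_monotone hev) => x.
exact: edist_le_of_add (itop_ge0 _) (itop_ge0 _) (itop_ge0 _) (fgh x) (gfh x).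
Qed.

Lemma wasserstein_smap (X Y : Type) (dX : X * X -> itop top)
    (dY : Y * Y -> itop top) (f : X -> Y) :
  nonexpansive dX dY f ->
  nonexpansive (wasserstein ev dX) (wasserstein ev dY) (smap F f).
Proof.
(* Without couplings of [t1] and [t2] the right-hand distance is [top], an upper bound for every
   distance. *)
move=> fP t1 t2; apply: le_iinf; first exact: itop_le_top.
move=> _ [t tP <-].
apply: le_trans (_ : sval (tilde ev dY (smap F (fun p => (f p.1, f p.2)) t)) <= _).
  by apply: iinf_le; eexists; first exact: coupling_smap tP.
by rewrite tilde_smap; apply: (wb_monotone hev) => -[x x'] /=; exact: fP.
Qed.

Lemma wasserstein_pseudometric (X : Type) (d : X * X -> itop top) :
  preserves_weak_pullbacks F ->
  is_pseudometric d -> is_pseudometric (wasserstein ev d).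
Proof.
move=> hF [d0 dC dD].
have le_swap t1 t2 : sval (wasserstein ev d (t2, t1)) <=
    sval (wasserstein ev d (t1, t2)).
  apply: le_iinf; first exact: itop_le_top.
  move=> _ [t tP <-]; apply: iinf_le.
  exists (smap F (fun p => (p.2, p.1)) t); first exact: coupling_swap.
  rewrite tilde_smap; congr (tilde ev _ t).
  by apply: funext => -[x y]; apply: itop_inj; exact: dC.
split=> [t|t1 t2|t1 t2 t3].
- apply/eqP; rewrite eq_le itop_ge0 andbT.
  (* The diagonal coupling costs nothing, since [d] vanishes on the diagonal. *)
  apply: le_trans (_ : sval (tilde ev d (smap F (fun x => (x, x)) t)) <= _).
    by apply: iinf_le; eexists; first exact: coupling_diag.
  by rewrite tilde_smap tilde_eq0.
- by apply/eqP; rewrite eq_le !le_swap.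
- apply: le_iinf_add_iinf; first exact: itop_le_top.
  move=> _ _ [s sP <-] [u uP <-].
  have [w [ws wu]] := coupling_glue hF sP uP.
  (* Forgetting the middle point of the glued element [w] leaves a coupling of [t1] and [t3]. *)
  apply: le_trans (_ : sval (tilde ev d (smap F (fun p => (p.1.1, p.2)) w)) <= _).
    apply: iinf_le; eexists; last by [].
    case: sP uP => /= <- _ [_ /= <-].
    by rewrite -ws -wu; split; rewrite /Fpi1 /Fpi2 !smap_comp.
  rewrite -ws -wu !tilde_smap; apply: tilde_subadditive => -[[x y] z] /=.
    exact: dD.
  (* The reverse bound [d(x, y) <= d(x, z) + d(y, z)] is the triangle inequality through [z], after
     symmetry. *)
  by rewrite (dC y z); exact: dD.
Qed.

End Wasserstein.

Theorem theorem5p22 (R : realType) (top : {posnum \bar R})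
    (F : functor SET SET) (ev : evaluation top F)
    (hF : preserves_weak_pullbacks F) (hev : well_behaved ev) :
  (exists (hW : forall X : PMET top,
             is_pseudometric (wasserstein ev (pdist X)))
          (hN : forall (X Y : PMET top) (f : mor X Y),
             nonexpansive (wasserstein ev (pdist X))
               (wasserstein ev (pdist Y)) (smap F f)),
      is_functor (wlift_map hW hN)) /\
  (forall (X Y : pmet top) (f : X -> Y),
      nonexpansive (pdist X) (pdist Y) f ->
      forall t1 t2 : F X,
        sval (wasserstein ev (pdist Y)
                (smap F f t1, smap F f t2))
        <= sval (wasserstein ev (pdist X) (t1, t2))).
Proof.
split; last by move=> X Y f fP; exact: wasserstein_smap.
exists (fun X => wasserstein_pseudometric hev hF (pdistP X)).
exists (fun X Y f => wasserstein_smap hev (nexpP f)).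
(* Nonexpansive maps are determined by their underlying functions, so the functor laws are those of
   [F]. *)
split=> [X|X Y Z g f]; apply: nexp_eq.
  exact: smap_id.
by apply: funext => t; rewrite /= smap_comp.
Qed.
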